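(* For all positive integers $t$ and $r$ with $t\ge 4$, for every $K_t$-minor-free graph $G$ and for every set $A$ of vertices of $G$, $$|\Pi_{r,G}[V(G)\to A]|\le \bigl(2^t(t-3)\bigr)^t\,(r+1)^{t^2-1}\,|A| .$$
   Context: All graphs are finite, simple and undirected. For a graph $G$, $A\subseteq V(G)$, $u\in V(G)$ and an integer $r\ge 0$, the profile $\pi_{r,G}[u\to A]$ is the function $A\to\{0,\dots,r,+\infty\}$ mapping $a\in A$ to $\mathrm{dist}_G(u,a)$ if $\mathrm{dist}_G(u,a)\le r$, and to $+\infty$ otherwise. For $U\subseteq V(G)$, $\Pi_{r,G}[U\to A]$ is the set of all profiles $\pi_{r,G}[u\to A]$ for $u\in U$, excluding the profile that is constantly $+\infty$. *)

(* Defs.v *)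
From mathcomp Require Import all_boot.

Set Implicit Arguments.
Unset Strict Implicit.
Unset Printing Implicit Defensive.

Record sgraph := SGraph {
  vertex :> finType;
  edge : rel vertex;
  edge_sym : symmetric edge;
  edge_irrefl : irreflexive edge }.

Definition complete_rel (n : nat) : rel 'I_n := fun i j => i != j.

Lemma complete_sym n : symmetric (@complete_rel n).
Proof. by move=> i j; rewrite /complete_rel eq_sym. Qed.

Lemma complete_irrefl n : irreflexive (@complete_rel n).
Proof. by move=> i; rewrite /complete_rel eqxx. Qed.

Definition complete_graph (n : nat) : sgraph :=
  SGraph (@complete_sym n) (@complete_irrefl n).

(* [connected_set S] is connectivity of the induced subgraph on [S]; the empty
   set satisfies it, and [minor] asks for nonempty branch sets separately. *)
Definition connected_set (G : sgraph) (S : {set G}) : Prop :=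
  {in S &, forall x y, connect [rel u v in S | edge u v] x y}.

Definition minor (H G : sgraph) : Prop :=
  exists phi : H -> {set G},
    [/\ forall i, phi i != set0,
        forall i, connected_set (phi i),
        forall i j, i != j -> [disjoint phi i & phi j] &
        forall i j, edge i j ->
          exists x y, [/\ x \in phi i, y \in phi j & edge x y]].

Section Distance.
Variable G : sgraph.

Definition has_walk (u v : G) (k : nat) : bool :=
  [exists p : k.-tuple G, path (@edge G) u p && (last u p == v)].

Lemma connect_has_walk (u v : G) :
  connect (@edge G) u v -> exists k, has_walk u v k.
Proof.
case/connectP=> p ep ->; exists (size p); apply/existsP.
by exists (in_tuple p); rewrite ep /=.
Qed.

Lemma has_walk_connect (u v : G) k : has_walk u v k -> connect (@edge G) u v.
Proof. by case/existsP=> p /andP[ep /eqP <-]; apply/connectP; exists p. Qed.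

(* [None] is the distance +oo between vertices of different components. *)
Definition dist (u v : G) : option nat :=
  match @idP (connect (@edge G) u v) with
  | ReflectT uv => Some (ex_minn (connect_has_walk uv))
  | ReflectF _ => None
  end.

Lemma dist_SomeP (u v : G) (k : nat) :
  dist u v = Some k <->
  has_walk u v k /\ (forall j, has_walk u v j -> k <= j).
Proof.
rewrite /dist; case: {-}_ / idP => [uv | nuv]; last first.
  by split=> // -[/has_walk_connect].
case: ex_minnP => m wm minm; split=> [[<-] // | [wk mink]].
by congr Some; apply/eqP; rewrite eqn_leq minm ?mink.
Qed.

Lemma dist_NoneP (u v : G) :
  dist u v = None <-> ~ connect (@edge G) u v.
Proof. by rewrite /dist; case: {-}_ / idP => [uv | nuv]; split. Qed.

End Distance.

(* The codomain [option 'I_r.+1] is {0, ..., r, +oo}, with [None] for +oo;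
   [insub d] is [Some d] when d <= r and [None] otherwise. *)
Definition profile_type (G : sgraph) (r : nat) (A : {set G}) : finType :=
  {ffun {a : G | a \in A} -> option 'I_r.+1}.

Definition profile (G : sgraph) (r : nat) (A : {set G}) (u : G) :
    profile_type r A :=
  [ffun a => obind (fun d : nat => insub d) (dist u (val a))].

Definition profiles (G : sgraph) (r : nat) (U A : {set G}) :
    {set profile_type r A} :=
  [set profile r A u | u in U] :\ [ffun => None].

(* Main.v *)
Require Import Defs.
From mathcomp Require Import all_boot zify.

(** Write k for [t - 2] and let [G] have no [K_t] minor.

    The graph is layered: there is a function [h] on the vertices whose level
    sets (the pieces) are connected and such that, for every vertex [v], the
    pieces strictly below [v] that touch the component [C] of [v] in the
    subgraph of vertices of height at least [h v] pairwise touch each other.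
    Together with [C] they form a clique minor, so there are at most k of them
    ([few_touched]).  The pieces are peeled off one by one: in a component [C]
    of what remains, the next piece is the union of at most [t - 3] shortest
    paths of [C] that start at a common vertex and lead to all the earlier
    pieces touching [C] ([next_piece], [extend_decomp], [decomposition]).

    Say that [v] weakly reaches [x] within distance d when a walk of length at
    most d leads from [v] to [x] without going below the height of [x].  A
    vertex weakly reaches at most (d+1)^k pieces, because the pieces and the
    relation of being touched from below form a chordal graph of width k
    ([near_chordal]); inside one piece it reaches at most (2d+1)(t-3) vertices,
    because on a shortest path the distances to the origin of the path differ
    by at most 2d over a ball of radius d ([card_wreach_piece]).  This bounds
    the weakly reachable sets ([card_wreach]).

    Every walk from [u] to [a] splits at its lowest vertex, which both ends
    weakly reach ([near_lowest]).  So the profile of [u] on [A] is determined by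
    the distances from [u] to the set X of the vertices that [u] weakly reaches
    within r and that some vertex of [A] weakly reaches within r.  If [v] is a
    highest vertex of X, then [v] weakly reaches all of X within 2r.  There are
    at most #|A| times (r+1)^k (2r+1)(t-3) choices for [v], and given [v] it
    remains to count the distance vectors truncated at r on a set of at most
    (2r+1)^k (4r+1)(t-3) vertices ([card_profiles]).

    Such a vector is recorded by the balls around the vertices of the set that
    contain [u].  If [t] balls were shattered, their weighted Voronoi cells
    would be the branch sets of a [K_t] minor ([shattered_balls_minor]), so the
    Sauer-Shelah lemma ([sauer]) bounds the number of vectors on s vertices by
    (s(r+1)+1)^(t-1) ([card_traces]).  The product of these bounds is the
    theorem. *)

Set Implicit Arguments.
Unset Strict Implicit.
Unset Printing Implicit Defensive.

(** * Walks of bounded length *)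

Lemma leq_exp_base m n k : m <= n -> m ^ k <= n ^ k.
Proof. by case: k => [|k] mn; rewrite ?expn0 // leq_exp2r. Qed.

Section Walks.
Variables (T : finType) (e : rel T).

(** The recursion extends the walk at its far end, where all the inductions
    below take place. *)
Fixpoint near (k : nat) (u v : T) : bool :=
  if k is k'.+1 then near k' u v || [exists w, near k' u w && e w v]
  else u == v.

Lemma near_refl k u : near k u u.
Proof. by elim: k => [|k IHk] /=; rewrite ?eqxx ?IHk. Qed.

Lemma near_mono k l u v : k <= l -> near k u v -> near l u v.
Proof.
move=> /subnKC <-; elim: (l - k) => [|d IHd] kuv; first by rewrite addn0.
by rewrite addnS /= IHd.
Qed.

Lemma near_rcons k u v w : near k u v -> e v w -> near k.+1 u w.
Proof. by move=> kuv evw /=; apply/orP; right; apply/existsP; exists v; rewrite kuv. Qed.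

Lemma near_trans k l u v w : near k u v -> near l v w -> near (k + l) u w.
Proof.
move=> kuv; elim: l w => [|l IHl] w /=; first by rewrite addn0 => /eqP <-.
rewrite addnS; case/orP=> [/IHl|/existsP[z /andP[/IHl kz ezw]]].
  exact: near_mono (leqnSn _).
exact: near_rcons kz ezw.
Qed.

Lemma near1 u v : e u v -> near 1 u v.
Proof. by move=> euv; apply: near_rcons euv; apply: near_refl. Qed.

Lemma nearC k u v : symmetric e -> near k u v -> near k v u.
Proof.
move=> eC; elim: k v => [|k IHk] v /=; first by rewrite eq_sym.
case/orP=> [/IHk -> //|/existsP[w /andP[/IHk kwu]]].
rewrite eC => /near1 vw; exact: near_trans vw kwu.
Qed.

Lemma near_connect k u v : near k u v -> connect e u v.
Proof.
elim: k v => [|k IHk] v /=; first by move/eqP->.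
case/orP=> [/IHk //|/existsP[w /andP[/IHk uw /connect1]]].
exact: connect_trans.
Qed.

Lemma path_near u p : path e u p -> near (size p) u (last u p).
Proof.
elim/last_ind: p => [|p x IHp] /=; first by rewrite eqxx.
by rewrite rcons_path size_rcons last_rcons => /andP[/IHp /near_rcons kp /kp].
Qed.

Lemma near_path k u v :
  near k u v -> exists2 p, path e u p /\ last u p = v & size p <= k.
Proof.
elim: k v => [|k IHk] v /=; first by move/eqP->; exists [::].
case/orP=> [/IHk[p ? ?]|/existsP[w /andP[/IHk[p [ep <-] sp] ewv]]].
  by exists p; rewrite ?leqW.
by exists (rcons p v); rewrite ?size_rcons // rcons_path last_rcons ep.
Qed.

Lemma connect_ex_near u v : connect e u v -> exists k, near k u v.
Proof. by case/connectP=> p /path_near kp ->; exists (size p). Qed.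

(** The distance in an arbitrary relation, with the value 0 outside of the
    component of [u]: the edges of a symmetric relation never leave a component,
    so the distance to [u] stays 1-Lipschitz along all of them
    ([gdist_lipschitz]). *)
Definition gdist (u v : T) : nat :=
  if @idP (connect e u v) is ReflectT uv then ex_minn (connect_ex_near uv)
  else 0.

Lemma near_gdist u v : connect e u v -> near (gdist u v) u v.
Proof. by rewrite /gdist; case: {-}_ / idP => // uv _; case: ex_minnP. Qed.

Lemma gdist_min k u v : near k u v -> gdist u v <= k.
Proof.
by rewrite /gdist; case: {-}_ / idP => // uv; case: ex_minnP => m _; apply.
Qed.

Lemma gdist_leE k u v : connect e u v -> (gdist u v <= k) = near k u v.
Proof.
move=> uv; apply/idP/idP; last exact: gdist_min.
by move/near_mono; apply; apply: near_gdist.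
Qed.

Lemma gdist_edge u v w : connect e u v -> e v w -> gdist u w <= (gdist u v).+1.
Proof.
by move=> uv vw; apply/gdist_min/(near_rcons _ vw)/near_gdist.
Qed.

Lemma gdist_pred u v : connect e u v -> u != v ->
  exists w, [/\ e w v, connect e u w & gdist u v = (gdist u w).+1].
Proof.
move=> uv nuv; move: (near_gdist uv).
case Dd: (gdist u v) => [|d] /=; first by rewrite (negPf nuv).
case/orP=> [/gdist_min|/existsP[w /andP[dw ewv]]]; first by rewrite Dd ltnn.
have cuw := near_connect dw; exists w; split=> //; congr _.+1; apply/eqP.
by rewrite eqn_leq (gdist_min dw) andbT -ltnS -Dd gdist_edge.
Qed.

End Walks.

Lemma sub_near (T : finType) (e e' : rel T) k u v :
  subrel e e' -> near e k u v -> near e' k u v.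
Proof.
move=> ee'; elim: k v => //= k IHk v.
case/orP=> [/IHk -> //|/existsP[w /andP[/IHk kw /ee' ewv]]].
exact: near_rcons kw ewv.
Qed.

Lemma sub_rel_connect (T : finType) (e e' : rel T) u v :
  subrel e e' -> connect e u v -> connect e' u v.
Proof. by move=> ee'; apply: connect_sub => x y /ee'; apply: connect1. Qed.

Lemma gdist_out (T : finType) (e : rel T) u v : ~~ connect e u v -> gdist e u v = 0.
Proof. by rewrite /gdist; case: {-}_ / idP => // uv; rewrite uv. Qed.

(** * Trees of shortest paths *)

Section BreadthFirst.
Variables (T : finType) (e : rel T) (u : T).
Hypothesis eC : symmetric e.

Lemma connect_near0 v : connect e u v -> gdist e u v = 0 -> v = u.
Proof. by move/near_gdist=> + d0; rewrite d0 => /eqP. Qed.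

Lemma gdist_lipschitz v w : e v w -> gdist e u w <= (gdist e u v).+1.
Proof.
move=> vw; have [uv|nuv] := boolP (connect e u v); first exact: gdist_edge.
rewrite [gdist e u w]gdist_out //; apply: contra nuv => uw.
by apply: connect_trans uw _; apply: connect1; rewrite eC.
Qed.

(** The vertices of a shortest path are told apart by their distance to its
    origin; this injectivity is all that the counting below asks of the path. *)
Lemma geodesic v : connect e u v ->
  exists P : {set T}, [/\ u \in P, v \in P,
    {in P, forall w, connect [rel x y in P | e x y] w u},
    {in P, forall w, gdist e u w <= gdist e u v} &
    {in P &, injective (gdist e u)}].
Proof.
elim: {v}_.+1 {-2}v (ltnSn (gdist e u v)) => // n IHn v + uv; rewrite ltnS => gn.
have [<-|neq] := eqVneq u v.
  exists [set u]; rewrite !inE; split=> // [w|w|w z]; rewrite !inE => /eqP->//.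
  by move=> /eqP->.
have [w [wv uw gv]] := gdist_pred uv neq.
have [|P [uP wP cP gP iP]] := IHn w _ uw; first by rewrite -gv.
have lt_v z : z \in P -> gdist e u z < gdist e u v by move/gP; rewrite gv ltnS.
exists (v |: P); split=> [||z|z|y z]; rewrite ?setU11 ?inE ?uP ?orbT //.
- have wu : connect [rel x y in v |: P | e x y] w u.
    apply: sub_rel_connect (cP w wP) => x y /= /andP[/andP[xP yP] ->].
    by rewrite !inE xP yP !orbT.
  case/orP=> [/eqP->|zP].
    apply: connect_trans wu; apply: connect1.
    by rewrite /= !inE eqxx wP orbT eC.
  apply: sub_rel_connect (cP z zP) => x y /= /andP[/andP[xP yP] ->].
  by rewrite !inE xP yP !orbT.
- by case/orP=> [/eqP->//|/lt_v/ltnW].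
- case/orP=> [/eqP->|/[dup] yP /lt_v lty]; case/orP=> [/eqP->|/[dup] zP /lt_v ltz] //.
  + by move=> eg; rewrite eg ltnn in ltz.
  + by move=> eg; rewrite eg ltnn in lty.
  exact: iP.
Qed.

(** Every shortest path contributes one vertex at each distance from the common
    origin [u].  The maximum with 1 accounts for the empty sequence, where only
    [u] is left, and at distance 0 the paths share [u]. *)
Lemma geodesic_union (s : seq T) : (forall v, v \in s -> connect e u v) ->
  exists H : {set T}, [/\ u \in H, {subset s <= H},
    {in H, forall w, connect [rel x y in H | e x y] w u} &
    forall d, #|[set w in H | gdist e u w == d]| <= maxn 1 (size s)].
Proof.
move=> us.
suff [H [uH sH cH dH]] : exists H : {set T}, [/\ u \in H, {subset s <= H},
    {in H, forall w, connect [rel x y in H | e x y] w u} &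
    forall d, 0 < d -> #|[set w in H | gdist e u w == d]| <= size s].
  exists H; split=> // -[|d]; last by rewrite leq_max dH ?orbT.
  rewrite leq_max -(cards1 u) subset_leq_card //; apply/subsetP=> w.
  rewrite !inE => /andP[/cH wu /eqP /connect_near0 -> //].
  rewrite (sym_connect_sym eC).
  by apply: sub_rel_connect wu => x y /andP[].
elim: s us => [|v s IHs] us.
  exists [set u]; split=> [||w|d d0]; rewrite ?inE ?eqxx //.
    by move/eqP->.
  rewrite leqn0 cards_eq0; apply/eqP/setP=> w; rewrite !inE.
  apply/andP=> -[/eqP-> /eqP gd].
  have := gdist_min (near_refl e 0 u); lia.
have [|H [uH sH cH dH]] := IHs; first by move=> w ws; apply: us; rewrite inE ws orbT.
have [|P [uP vP cP _ iP]] := @geodesic v; first by apply: us; rewrite inE eqxx.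
exists (P :|: H); split=> [|w|w|d d0].
- by rewrite inE uP.
- by rewrite !inE => /orP[/eqP->|/sH->]; rewrite ?vP ?orbT.
- rewrite inE => /orP[/cP|/cH]; apply: sub_rel_connect => x y /= /andP[/andP[xP yP] ->];
  by rewrite !inE xP yP ?orbT.
apply: leq_trans (_ : #|[set w in P | gdist e u w == d] :|:
   [set w in H | gdist e u w == d]| <= _).
  by apply/subset_leq_card/subsetP=> w; rewrite !inE andb_orl.
apply: leq_trans (leq_card_setU _ _) _.
rewrite -[size (v :: s)]add1n leq_add ?dH //.
apply/card_le1_eqP=> x y; rewrite !inE => /andP[xP /eqP gx] /andP[yP /eqP gy].
by apply: iP; rewrite // gx.
Qed.
End BreadthFirst.

(** * Counting by fibres and by shattering *)

Lemma card_fibers (T I : finType) (f : T -> I) (A : {set T}) (B : {set I}) c :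
    {in A, forall x, f x \in B} ->
    {in B, forall j, #|[set x in A | f x == j]| <= c} ->
  #|A| <= #|B| * c.
Proof.
move=> fAB fc; rewrite -sum1_card (partition_big f (mem B)) //= -sum_nat_const.
apply: leq_sum => j /fc; apply: leq_trans.
by rewrite sum1_card; apply/subset_leq_card/subsetP=> x; rewrite !inE.
Qed.

Section Sauer.
Variable T : finType.
Implicit Types (F : {set {set T}}) (S Y Z B : {set T}).

Definition shatters F Y := forall Z, Z \subset Y -> exists2 B, B \in F & B :&: Y = Z.

(** Split [F] at an element [s] of [S]: forgetting [s] merges the sets of [F2]
    with their extensions by [s].  The traces [F1] shatter nothing new, and a
    set shattered by [F2] can be enlarged by [s] within [F], so the bound
    follows from n^d + n^(d-1) <= (n+1)^d. *)
Lemma sauer F S d :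
  {in F, forall B, B \subset S} -> (forall Y, #|Y| = d.+1 -> ~ shatters F Y) ->
  #|F| <= #|S|.+1 ^ d.
Proof.
have [n] := ubnP #|S|; elim: n F S d => // n IHn F S d; rewrite ltnS => leSn FS nF.
have [S0|[s sS]] := set_0Vmem S.
  rewrite S0 cards0 exp1n -(cards1 (set0 : {set T})); apply/subset_leq_card.
  by apply/subsetP=> B /FS; rewrite S0 inE subset0.
pose F1 := [set B :\ s | B in F].
pose F2 := [set B in F | (s \notin B) && (s |: B \in F)].
have cS : #|S| = #|S :\ s|.+1 by rewrite (cardsD1 s) sS.
have leS' : #|S :\ s| < n by rewrite -cS.
have cF : #|F| <= #|F1| + #|F2|.
  (* [F0] contains one set of each pair that differs by [s] only. *)
  pose F0 := [set B in F | (s \notin B) || (B :\ s \notin F)].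
  have cF0 : #|F0| <= #|F1|.
    rewrite -(card_in_imset (f := fun B => B :\ s) (D := F0)).
      apply/subset_leq_card/subsetP=> _ /imsetP[B /[!inE]/andP[BF _] ->].
      exact: imset_f.
    move=> B C /[!inE] /andP[BF hB] /andP[CF hC] eBC.
    have [sB|sB] := boolP (s \in B); have [sC|sC] := boolP (s \in C).
    - by rewrite -(setD1K sB) -(setD1K sC) eBC.
    - have eC : C :\ s = C by apply/setDidPl; rewrite disjoint_sym disjoints1.
      by move: hB; rewrite sB eBC eC CF.
    - have eB : B :\ s = B by apply/setDidPl; rewrite disjoint_sym disjoints1.
      by move: hC; rewrite sC -eBC eB BF.
    - have eB : B :\ s = B by apply/setDidPl; rewrite disjoint_sym disjoints1.
      have eC : C :\ s = C by apply/setDidPl; rewrite disjoint_sym disjoints1.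
      by rewrite -eB -eC.
  have cF2 : #|F :\: F0| <= #|F2|.
    rewrite -(card_in_imset (f := fun B => B :\ s) (D := F :\: F0)).
      apply/subset_leq_card/subsetP=> _ /imsetP[B /[!inE]/andP[+ BF] ->].
      rewrite BF /= negb_or !negbK => /andP[sB BsF].
      by rewrite BsF !inE eqxx /= setD1K.
    move=> B C; rewrite !inE => /andP[+ BF] /andP[+ CF].
    rewrite BF CF /= !negb_or !negbK => /andP[sB _] /andP[sC _] eBC.
    by rewrite -(setD1K sB) -(setD1K sC) eBC.
  rewrite -(cardsID F0 F) leq_add //; apply: leq_trans cF0.
  exact/subset_leq_card/subsetIr.
have F1S : {in F1, forall B, B \subset S :\ s}.
  by move=> _ /imsetP[B /FS BS ->]; apply: setSD.
have F2S : {in F2, forall B, B \subset S :\ s}.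
  by move=> B /[!inE] /and3P[/FS BS sB _]; rewrite subsetD1 BS.
have F1d : #|F1| <= #|S :\ s|.+1 ^ d.
  apply: IHn F1S _ => // Y cY F1Y; apply: (nF Y cY) => Z ZY.
  have sY : s \notin Y.
    have [B /imsetP[C _ ->] eY] := F1Y Y (subxx Y).
    by rewrite -eY !inE eqxx.
  have [_ /imsetP[C CF ->] <-] := F1Y Z ZY; exists C => //.
  apply/setP=> y; rewrite !inE; case: eqP => // ->.
  by rewrite (negPf sY) !andbF.
have F2n Y : #|Y| = d -> ~ shatters F2 Y.
  move=> cY F2Y; have sY : s \notin Y.
    have [B /[!inE]/and3P[_ sB _] eY] := F2Y Y (subxx Y).
    by rewrite -eY inE (negPf sB).
  apply: (nF (s |: Y)) => [|Z ZY]; first by rewrite cardsU1 sY cY.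
  have ZY' : Z :\ s \subset Y by rewrite subDset.
  have [B /[!inE]/and3P[BF sB sBF] eZ] := F2Y _ ZY'.
  have [sZ|sZ] := boolP (s \in Z).
    exists (s |: B) => //; rewrite -setUIr eZ; exact: setD1K.
  exists B => //; have <- : Z :\ s = Z by apply/setDidPl; rewrite disjoint_sym disjoints1.
  rewrite -eZ; apply/setP=> y; rewrite !inE; case: (y =P s) => // ->.
  by rewrite (negPf sB).
apply: leq_trans cF _; rewrite cS; case: d nF F1d F2n => [_|d _] F1d F2n.
  have -> : F2 = set0.
    apply/eqP/set0Pn => -[B BF2]; apply: (F2n set0) (cards0 T) _ => Z.
    by rewrite subset0 => /eqP->; exists B; rewrite ?setI0.
  by rewrite cards0 addn0.
have F2d := IHn _ _ d leS' F2S F2n.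
apply: leq_trans (leq_add F1d F2d) _.
by rewrite expnS -mulSnr [in leqRHS]expnS leq_mul2l /= leq_exp_base.
Qed.
End Sauer.

(** * Shattered balls yield a clique minor *)

Section Minors.
Variable G : sgraph.
Implicit Types (X Y S : {set G}).

Lemma edge_connectC : connect_sym (@edge G).
Proof. by apply: sym_connect_sym; apply: edge_sym. Qed.

Definition touching X Y := exists x y, [/\ x \in X, y \in Y & edge x y].

Lemma clique_minor (I : finType) (J : {set I}) (f : I -> {set G}) t :
    t <= #|J| ->
    {in J, forall i, f i != set0 /\ connected_set (f i)} ->
    {in J &, forall i j, i != j -> [disjoint f i & f j] /\ touching (f i) (f j)} ->
  minor (complete_graph t) G.
Proof.
move=> tJ fJ fJJ; pose g (i : 'I_t) := enum_val (widen_ord tJ i).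
have gJ i : g i \in J by apply: enum_valP.
have gI i j : i != j -> g i != g j.
  apply: contra_neq => /enum_val_inj eij; apply: val_inj.
  exact: (congr1 (@nat_of_ord _) eij).
exists (fun i => f (g i)); split=> [i|i|i j /gI ij|i j /gI ij].
- by case: (fJ _ (gJ i)).
- by case: (fJ _ (gJ i)).
- by case: (fJJ _ _ (gJ i) (gJ j) ij).
- by case: (fJJ _ _ (gJ i) (gJ j) ij).
Qed.

Lemma restr_connectC S : connect_sym [rel x y in S | @edge G x y].
Proof.
by apply: sym_connect_sym => x y /=; rewrite edge_sym [(x \in S) && _]andbC.
Qed.

Lemma connected_star S x :
  {in S, forall y, connect [rel x y in S | edge x y] y x} -> connected_set S.
Proof.
by move=> Sx y z /Sx yx /Sx; rewrite restr_connectC; apply: connect_trans.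
Qed.

(** The walk has a first step out of [X]. *)
Lemma connect_touching X Y x y : x \in X -> y \in Y -> [disjoint X & Y] ->
  connect [rel u v in X :|: Y | edge u v] x y -> touching X Y.
Proof.
move=> xX yY dXY /connectP[p]; elim: p x xX => [|z p IHp] x xX /=.
  by move=> _ yx; have := disjointFr dXY xX; rewrite -yx yY.
case/andP=> /andP[/andP[_ +] xz] pz ylast; rewrite inE.
by case/orP=> [zX|zY]; [apply: IHp pz ylast | exists x, z].
Qed.
End Minors.

Section Voronoi.
Variables (G : sgraph) (I : finType) (x : I -> G) (b : I -> nat) (N : nat).
Hypothesis x_connect : forall i j, connect (@edge G) (x i) (x j).

Let cost (i : I) (z : G) := N * gdist (@edge G) (x i) z + b i.

(** With [L] everything but [i] this is the Voronoi cell of the site [x i], for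
    the distance scaled by [N] and shifted by [b]; smaller sets [L] give regions
    in which only the sites of [L] are excluded. *)
Definition closer (i : I) (L : pred I) : {set G} :=
  [set z | connect (@edge G) (x i) z && [forall (j | L j), cost i z < cost j z]].

Lemma closerP i (L : pred I) z :
  reflect (connect (@edge G) (x i) z /\ forall j, L j -> cost i z < cost j z)
          (z \in closer i L).
Proof. by rewrite inE; apply: (iffP andP) => -[-> /forall_inP]. Qed.

Arguments closerP {i L z}.

(** One step along a shortest path to [x i] lowers the cost of [i] by exactly
    [N], and lowers the cost of any other site by at most [N]; so shortest paths
    to [x i] stay in the region. *)
Lemma closer_star i (L : pred I) z :
  z \in closer i L ->
    x i \in closer i L /\
    connect [rel u v in closer i L | edge u v] z (x i).
Proof.
elim: {z}_.+1 {-2}z (ltnSn (gdist (@edge G) (x i) z)) => // n IHn z + zL.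
rewrite ltnS => gn; have [xz cz] := closerP zL.
have [eqz|neqz] := eqVneq (x i) z; first by rewrite {1}eqz eqz connect0.
have [w [wz xw gz]] := gdist_pred xz neqz.
have wL : w \in closer i L.
  apply/closerP; split=> // j Lj; have := cz j Lj; rewrite /cost gz.
  have xjw := connect_trans (x_connect j i) xw.
  have := leq_mul (leqnn N) (gdist_edge xjw wz); rewrite !mulnS; lia.
have [|-> wx] := IHn w _ wL; first by rewrite -gz.
split=> //; apply: connect_trans wx; apply: connect1.
by rewrite /= zL wL edge_sym.
Qed.
End Voronoi.
Arguments closerP {G I x b N i L z}.

(** The branch sets are the Voronoi cells of the centres [x p] for the distance
    diminished by the radius [i p].  A vertex lying in the balls of p and q only
    is strictly closer to both centres than to any other, and remains so along
    shortest paths to [x p] and [x q]: these two paths stay in the union of the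
    two cells, which therefore touch. *)
Lemma shattered_balls_minor (G : sgraph) t r (x : 'I_t -> G) (i : 'I_t -> nat) :
    (forall p, i p <= r) ->
    (forall Z : {set 'I_t}, exists u, forall p,
       near (@edge G) (i p) (x p) u = (p \in Z)) ->
  minor (complete_graph t) G.
Proof.
move=> ir sh.
have [u0 u0P] := sh [set: 'I_t].
have x_u0 p : connect (@edge G) (x p) u0 by apply: (@near_connect _ _ (i p)); rewrite u0P inE.
have x_x p q : connect (@edge G) (x p) (x q).
  by apply: connect_trans (x_u0 p) _; rewrite edge_connectC.
(* Scaling by [t] and adding the index breaks ties; [r -] keeps the shift
   nonnegative. *)
pose b (p : 'I_t) := t * (r - i p) + p.
pose cost p z := t * gdist (@edge G) (x p) z + b p.
pose S := @closer G _ x b t.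
have shS (Z : {set 'I_t}) p : p \in Z -> exists u, forall q, q \in Z -> u \in S q [pred l | l \notin Z].
  move=> pZ; have [u uP] := sh Z; exists u => q qZ.
  have xp_u : connect (@edge G) (x p) u by apply: (@near_connect _ _ (i p)); rewrite uP.
  have x_u l : connect (@edge G) (x l) u by apply: connect_trans xp_u.
  apply/closerP; split=> // l lZ.
  have := uP q; rewrite qZ -gdist_leE // => qu.
  have := uP l; rewrite (negPf lZ) -gdist_leE // => /negbT; rewrite -ltnNge => lu.
  rewrite /b !addnA -!mulnDr.
  have le1 : gdist (@edge G) (x q) u + (r - i q) <= r by have := ir q; lia.
  have le2 : r < gdist (@edge G) (x l) u + (r - i l) by have := ir l; lia.
  have := leq_mul (leqnn t) le1; have := leq_mul (leqnn t) le2.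
  by rewrite mulnS; have := ltn_ord q; lia.
pose cell p := S p (predC1 p).
have cell_x p : x p \in cell p.
  have [|u /(_ p)] := shS [set p] p; rewrite ?set11 // => /(_ isT) uS.
  have /(closer_star x_x) : u \in cell p.
    have [cu uc] := closerP uS; apply/closerP; split=> // j jp.
    by apply: uc; rewrite !inE.
  by case.
apply: (@clique_minor _ _ [set: 'I_t] cell); first by rewrite cardsT card_ord.
  move=> p _; split; first by apply/set0Pn; exists (x p).
  by apply: (@connected_star _ _ (x p)) => z /closer_star -[].
move=> p q _ _ npq.
have dpq : [disjoint cell p & cell q].
  apply/pred0P=> z /=; apply/negP=> /andP[/closerP[_ /(_ q)] + /closerP[_ /(_ p)]].
  by rewrite /= npq eq_sym npq => /(_ isT) lt1 /(_ isT); lia.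
split=> //; apply: (@connect_touching _ _ _ (x p) (x q)) => //.
have [|u uS] := shS [set p; q] p; first by rewrite !inE eqxx.
have subS s : s \in [set p; q] -> S s [pred l | l \notin [set p; q]] \subset cell p :|: cell q.
  move=> spq; apply/subsetP=> z /closerP[xz zc].
  (* [o] is whichever of p and q is cheaper at [z]. *)
  have [o [opq] oz] : exists o, o \in [set p; q] /\ (forall l, l != o -> cost o z < cost l z).
    have neq : cost p z != cost q z.
      apply: contra npq => /eqP/(congr1 (modn^~ t)).
      by rewrite /cost /b !addnA -!mulnDr !(mulnC t) !modnMDl !modn_small // => /val_inj->.
    have [lt|ge] := ltnP (cost p z) (cost q z).
      exists p; split=> [|l nlp]; first by rewrite !inE eqxx.
      have [->//|nlq] := eqVneq l q.
      have := zc l; rewrite !inE (negPf nlp) (negPf nlq) => /(_ isT).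
      by move: spq; rewrite !inE => /orP[]/eqP ->; rewrite -!/(cost _ _); lia.
    exists q; split=> [|l nlq]; first by rewrite !inE eqxx orbT.
    have [->|nlp] := eqVneq l p; first by lia.
    have := zc l; rewrite !inE (negPf nlp) (negPf nlq) => /(_ isT).
    by move: spq; rewrite !inE => /orP[]/eqP ->; rewrite -!/(cost _ _); lia.
  have zo : z \in cell o by apply/closerP; split=> //; apply: connect_trans xz.
  by move: opq; rewrite in_set2 in_setU => /orP[]/eqP eo; rewrite eo in zo; rewrite zo ?orbT.
have to_x s : s \in [set p; q] -> connect [rel u v in cell p :|: cell q | edge u v] u (x s).
  move=> spq; have [_] := closer_star x_x (uS s spq).
  apply: sub_rel_connect => y z /= /andP[/andP[yS zS] ->].
  by rewrite !(subsetP (subS s spq)).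
apply: connect_trans (to_x q _); last by rewrite !inE eqxx orbT.
by rewrite restr_connectC; apply: to_x; rewrite !inE eqxx.
Qed.

(** * Descending walks in chordal graphs *)

Section Chordal.
Variable n : nat.
Implicit Type E : rel 'I_n.

(** Let [b] be the smallest successor of [i].  By the clique condition every
    vertex above [b] that a walk from [i] meets before going below [b] has [b]
    as a successor.  Hence the targets above [b] are reached in a relation of
    outdegree one less, and all the others are reached from [b] with one step
    saved; the bound follows from (s+2)^k + (s+1)^(k+1) <= (s+2)^(k+1). *)
Lemma near_chordal k s E (i : 'I_n) :
    (forall x y, E x y -> y < x) ->
    (forall x y z, E x y -> E x z -> y < z -> E z y) ->
    (forall x, connect E i x -> #|[set y | E x y]| <= k) ->
  #|[set j | near E s i j]| <= s.+1 ^ k.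
Proof.
elim: k E s i => [|k IHk] E s i Edec Ecl.
  move=> E0; rewrite expn0 -(cards1 i) subset_leq_card //; apply/subsetP=> j.
  rewrite !inE; elim: s j => [|s IHs] j /=; first by rewrite eq_sym.
  case/orP=> [/IHs //|/existsP[w /andP[/IHs/eqP-> Eij]]].
  have /(_ i (connect0 _ _)) := E0; rewrite leqn0 cards_eq0 => /eqP/setP/(_ j).
  by rewrite !inE Eij.
elim: s i => [|s IHs] i degE.
  rewrite exp1n -(cards1 i) subset_leq_card //; apply/subsetP=> j.
  by rewrite !inE eq_sym.
have [b0 Eib0|noE] := pickP (E i); last first.
  apply: (@leq_trans 1); last by rewrite expn_gt0.
  rewrite -(cards1 i) subset_leq_card //; apply/subsetP=> j.
  rewrite !inE; elim: s.+1 j => [|s' IHs'] j /=; first by rewrite eq_sym.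
  case/orP=> [/IHs' //|/existsP[w /andP[/IHs'/eqP-> ]]].
  by rewrite noE.
case: (@arg_minnP _ b0 (E i) val Eib0) => b Eib minb.
pose E' := [rel x y | E x y && (b < y)].
have subE : subrel E' E by move=> x y /andP[].
have Eb x : connect E' i x -> E x b.
  case/connectP=> p pE ->; elim/last_ind: p pE => [|p y IHp] //=.
  rewrite rcons_path last_rcons => /andP[/IHp Ezb /andP[Ezy ltby]].
  exact: (Ecl _ _ _ Ezb Ezy ltby).
have cE' : #|[set j | near E' s.+1 i j]| <= s.+2 ^ k.
  apply: IHk => [x y /subE/Edec //|x y z /andP[? ?] /andP[? ?] ltyz|x cix].
    by rewrite /= (Ecl x).
  have := degE x (sub_rel_connect subE cix).
  rewrite (cardsD1 b) inE Eb // add1n ltnS; apply: leq_trans.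
  apply/subset_leq_card/subsetP=> y; rewrite !inE => /andP[-> ltby].
  by rewrite andbT; apply: contraTneq ltby => ->; rewrite ltnn.
have cb : #|[set j | near E s b j]| <= s.+1 ^ k.+1.
  by apply: IHs => x cbx; apply: degE; apply: connect_trans cbx; apply: connect1.
have split_walk q j : near E q i j ->
    near E' q i j \/ (0 < q /\ near E q.-1 b j).
  elim: q j => [|q IHq] j /=; first by move=> ->; left.
  case/orP=> [/IHq[->|[q0 qb]]|]; first by left.
    by right; split=> //; apply: near_mono qb; apply: leq_pred.
  case/existsP=> w /andP[/IHq[iw|[q0 bw]] Ewj]; last first.
    by right; split=> //; rewrite -(prednK q0); apply: near_rcons Ewj.
  have [ltbj|lejb] := ltnP b j.
    by left; apply/orP; right; apply/existsP; exists w; rewrite iw /= Ewj.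
  right; split=> //; have Ewb := Eb w (near_connect iw).
  have [->|neqjb] := eqVneq j b; first exact: near_refl.
  have ltjb : j < b by rewrite ltn_neqAle lejb andbT.
  (* Saving a step is possible since a one-step walk cannot go below the least
     successor [b]. *)
  case: q iw {IHq} => [|q] iw.
    by move: iw Ewj => /= /eqP <- /minb; rewrite leqNgt ltjb.
  apply: (@near_mono _ _ 1) => //; apply: near1; exact: (Ecl _ _ _ Ewj Ewb ltjb).
apply: (@leq_trans (#|[set j | near E' s.+1 i j]| + #|[set j | near E s b j]|)).
  apply: leq_trans (leq_card_setU _ _); apply/subset_leq_card/subsetP=> j.
  rewrite inE => /split_walk; rewrite !inE => -[->//|[_ ->]].
  by rewrite orbT.
apply: leq_trans (leq_add cE' cb) _.
rewrite [s.+2 ^ k.+1]expnS mulSnr addnC leq_add2r expnS leq_mul2l /=.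
exact: leq_exp_base.
Qed.
End Chordal.

(** * Layering a graph without a large clique minor *)

Section Decomposition.
Variable G : sgraph.
Implicit Types (h : G -> nat) (u v w x y z : G).

Definition above h (l : nat) : rel G :=
  [rel x y | [&& l <= h x, l <= h y & edge x y]].

Definition piece h (i : nat) : {set G} := [set v | h v == i].

Definition touch h v (j : nat) : bool :=
  (j < h v) && [exists w, exists z,
    [&& connect (above h (h v)) v w, edge w z & h z == j]].

Lemma touchP h v j :
  reflect (j < h v /\ exists w z, [/\ connect (above h (h v)) v w, edge w z & h z = j])
          (touch h v j).
Proof.
apply: (iffP andP) => -[-> ].
  case/existsP=> w /existsP[z /and3P[vw wz /eqP hz]]; split=> //.
  by exists w, z.
case=> w [z [vw wz /eqP hz]]; split=> //; apply/existsP; exists w.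
by apply/existsP; exists z; apply/and3P.
Qed.

Lemma above_sym h l : symmetric (above h l).
Proof. by move=> x y; rewrite /above /= edge_sym andbCA. Qed.

Lemma above_connectC h l : connect_sym (above h l).
Proof. exact/sym_connect_sym/above_sym. Qed.

Lemma above_le h k l : k <= l -> subrel (above h l) (above h k).
Proof. by move=> kl x y /and3P[lx ly exy]; apply/and3P; split=> //; apply: leq_trans kl _. Qed.

Lemma connect_above h l v w : connect (above h l) v w -> l <= h v -> l <= h w.
Proof.
case/connectP=> p pp ->; elim/last_ind: p pp => //= p x IHp.
by rewrite rcons_path last_rcons => /andP[_ /and3P[]].
Qed.

(** The state after [m] pieces have been removed: the vertices of height [m] are
    those that remain, so that the subgraphs [above h i] with [i <= m] do not
    change when further pieces are removed.  The function [delta] of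
    [pdec_thin] will be the distance to the origin of the shortest paths that
    make up the piece. *)
Record partial_decomp (k : nat) h (m : nat) : Prop := PartialDecomp {
  pdec_le : forall v, h v <= m;
  pdec_connected : forall i, i < m -> connected_set (piece h i);
  pdec_clique : forall v i j, touch h v i -> touch h v j -> i != j ->
    touching (piece h i) (piece h j);
  pdec_thin : forall i, i < m -> exists delta : G -> nat,
    (forall x y, above h i x y -> delta y <= (delta x).+1) /\
    forall d, #|[set w in piece h i | delta w == d]| <= k }.

Variables (t : nat) (t_ge4 : 4 <= t) (Kt_free : ~ minor (complete_graph t) G).

Lemma connect_comp (e : rel G) v w : connect e v w ->
  connect [rel x y in [set z | connect e v z] | e x y] v w.
Proof.
case/connectP=> p pp ->; elim/last_ind: p pp => [|p x IHp] //=.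
rewrite rcons_path last_rcons => /andP[pp px].
apply: connect_trans (IHp pp) _; apply: connect1.
have vl : connect e v (last v p) by apply/connectP; exists p.
by rewrite /= !inE vl px (connect_trans vl (connect1 px)).
Qed.

(** The touched pieces and the component of [v] are the branch sets of a clique
    minor. *)
Lemma few_touched k h m v n : partial_decomp k h m ->
  #|[set j : 'I_n | touch h v j]| <= t - 2.
Proof.
case=> hm hconn hadj _; rewrite leqNgt; apply/negP=> lt; apply: Kt_free.
pose comp := [set w | connect (above h (h v)) v w].
pose f (o : option 'I_n) := if o is Some j then piece h j else comp.
have fNone (j : 'I_n) : touch h v j -> [disjoint comp & piece h j] /\ touching comp (piece h j).
  case/touchP=> jv [w [z [vw wz hz]]]; split; last first.
    by exists w, z; rewrite !inE hz.
  apply/pred0P=> y /=; apply/negP; rewrite !inE => /andP[/connect_above].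
  by move=> /(_ (leqnn _)) + /eqP hy; rewrite hy leqNgt jv.
apply: (@clique_minor _ _ (None |: Some @: [set j : 'I_n | touch h v j]) f).
- rewrite cardsU1 (card_imset _ Some_inj).
  have -> : None \notin Some @: [set j : 'I_n | touch h v j].
    by apply/imsetP=> -[].
  move: lt t_ge4; lia.
- move=> [j|]; rewrite !inE /=.
    case/imsetP=> i + [->]; rewrite inE => /touchP[iv [w [z [_ _ hz]]]].
    split; last by apply: hconn; apply: leq_trans iv (hm v).
    by apply/set0Pn; exists z; rewrite inE hz.
  move=> _; split; first by apply/set0Pn; exists v; rewrite inE.
  apply: (@connected_star _ _ v) => w; rewrite inE => /connect_comp vw.
  rewrite restr_connectC; apply: sub_rel_connect vw => x y /= /andP[-> ].
  by case/and3P.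
move=> [i|] [j|] //; rewrite !inE /=.
- case/imsetP=> i' + [->] /imsetP[j' + [->]]; rewrite !inE => ti tj nij.
  split; last by apply: hadj ti tj _; apply: contraNneq nij => /val_inj->.
  apply/pred0P=> x /=; apply/negP; rewrite !inE => /andP[/eqP-> /eqP/val_inj ij].
  by rewrite ij eqxx in nij.
- case/imsetP=> i' + [->] _ _; rewrite inE => /fNone[dj [x [y [xc yp xy]]]].
  split; first by rewrite disjoint_sym.
  by exists y, x; rewrite edge_sym.
by move=> _ /imsetP[j' + [->]] _; rewrite inE => /fNone.
Qed.

(** Choose in the component of [v] one vertex next to each of the at most [t - 2]
    touched pieces and join one of them, [u], to the others by at most [t - 3]
    shortest paths. *)
Lemma next_piece h m v : partial_decomp (t - 3) h m -> h v = m ->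
  exists H : {set G}, exists u,
    [/\ u \in H, {in H, forall w, connect (above h m) v w}, connected_set H,
        forall j, touch h v j -> touching H (piece h j) &
        forall d, #|[set w in H | gdist (above h m) u w == d]| <= t - 3].
Proof.
move=> dec hv; set e := above h m.
pose N := [set j : 'I_m | touch h v j].
have cN : #|N| <= t - 2 by apply: few_touched dec.
pose rep (j : nat) := odflt v [pick w | connect e v w && [exists z, edge w z && (h z == j)]].
have repP j : touch h v j -> connect e v (rep j) /\ exists2 z, edge (rep j) z & h z = j.
  case/touchP=> _ [w [z [vw wz hz]]]; rewrite /rep; case: pickP => [w' /=|/(_ w)].
    by case/andP=> -> /existsP[z' /andP[? /eqP]]; split=> //; exists z'.
  rewrite /e -hv vw /=; move=> /negbT/existsP[]; exists z.
  by rewrite wz hz eqxx.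
have [u vu [s us sN]] : exists2 u, connect e v u & exists2 s,
    size s <= t - 3 & (forall w, w \in s -> connect e v w) /\
    forall j, touch h v j -> rep j \in u :: s.
  case eN : (enum N) => [|j0 s].
    exists v => //; exists [::] => //; split=> // j tj.
    have jm : j < m by have /touchP[] := tj; rewrite hv.
    by have := mem_enum N (Ordinal jm); rewrite eN !inE /= tj.
  have sz : (size s).+1 <= t - 2 by rewrite (leq_trans _ cN) // cardE eN.
  have inN j : j \in j0 :: s -> touch h v j by rewrite -eN mem_enum inE.
  exists (rep j0); first by case: (repP j0); rewrite // inN ?mem_head.
  exists [seq rep (val j) | j <- s]; first by rewrite size_map -ltnS; apply: leq_trans sz _; lia.
  split=> [w /mapP[j js ->]|j tj].
    by case: (repP j); rewrite // inN // inE js orbT.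
  have jm : j < m by have /touchP[] := tj; rewrite hv.
  have : Ordinal jm \in enum N by rewrite mem_enum inE.
  rewrite eN inE => /orP[/eqP<-|js]; first exact: mem_head.
  by rewrite inE; apply/orP; right; apply/mapP; exists (Ordinal jm).
case: sN => vs sN.
have [|H [uH sH cH dH]] := @geodesic_union _ e u (@above_sym h m) s.
  by move=> w /vs; apply: connect_trans; rewrite above_connectC.
exists H, u; split=> // [w /cH wu||j tj|d].
- apply: connect_trans vu _; rewrite above_connectC.
  by apply: sub_rel_connect wu => x y /andP[].
- apply: (@connected_star _ _ u) => w /cH; apply: sub_rel_connect => x y /=.
  by case/andP=> -> /and3P[].
- have [_ [z rz hz]] := repP j tj; exists (rep j), z.
  rewrite inE hz; split=> //.
  by have := sN j tj; rewrite inE => /orP[/eqP->|/sH].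
by apply: leq_trans (dH d) _; rewrite geq_max us andbT; lia.
Qed.

(** The heights of the remaining vertices outside of [H] are raised by one.  A
    component left over that touches [H] was part of the component of [v], so
    the earlier pieces that it touches also touch [H]. *)
Lemma extend_decomp h m v : partial_decomp (t - 3) h m -> h v = m ->
  exists h', partial_decomp (t - 3) h' m.+1 /\
    #|[set w | h' w == m.+1]| < #|[set w | h w == m]|.
Proof.
move=> dec hv; have [H [u [uH Hv cH tH thinH]]] := next_piece dec hv.
have hH w : w \in H -> h w = m.
  move/Hv/connect_above; rewrite hv => /(_ (leqnn _)) mw.
  by apply/eqP; rewrite eqn_leq mw (pdec_le dec).
pose h' w := if (h w == m) && (w \notin H) then m.+1 else h w.
have le_hm w := pdec_le dec w.
have h'_ge l w : l <= m -> (l <= h' w) = (l <= h w).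
  move=> lm; rewrite /h'; case: ifP => // /andP[/eqP-> _].
  by rewrite lm leqW.
have h'_H w : w \in H -> h' w = m by move=> wH; rewrite /h' wH andbF hH.
have h'_m w : (h' w == m) = (w \in H).
  apply/eqP/idP => [|/h'_H//]; rewrite /h'; case: ifPn => [_|].
    by move/eqP; rewrite eqn_leq ltnn.
  by rewrite negb_and negbK => /orP[/eqP//|].
have h'_eq w j : j < m -> (h' w == j) = (h w == j).
  move=> jm; rewrite /h'; case: ifP => // /andP[/eqP-> _].
  by rewrite !gtn_eqF // leqW.
have above' l : l <= m -> above h' l =2 above h l.
  by move=> lm x y; rewrite /above /= !h'_ge.
have piece' j : j < m -> piece h' j = piece h j.
  by move=> jm; apply/setP=> w; rewrite !inE h'_eq.
have pieceH : piece h' m = H by apply/setP=> w; rewrite inE h'_m.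
have touch' w j : touch h' w j -> j < m -> touch h w j.
  case/touchP=> jw [x [z [wx xz hz]]] jm; apply/touchP; split.
    move: jw; rewrite /h'; case: ifP => // /andP[/eqP-> //].
  exists x, z; split=> //; last by apply/eqP; rewrite -h'_eq ?hz.
  have hw : h w <= h' w by rewrite /h'; case: ifP => // /andP[/eqP-> _].
  apply: sub_rel_connect wx => a b /(above_le hw).
  by rewrite above' // le_hm.
have touchm w j : touch h' w m -> touch h' w j -> j < m -> touching H (piece h j).
  case/touchP=> mw [x [z [wx xz /eqP]]]; rewrite h'_m => zH tj jm; apply: tH.
  have hw : h w = m by move: mw; rewrite /h'; case: ifP => [/andP[/eqP]|_]; rewrite ?ltnNge ?le_hm.
  have /touchP[_ [a [b [wa ab hb]]]] := touch' _ _ tj jm.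
  apply/touchP; rewrite hv; split=> //; exists a, b; split=> //.
  apply: connect_trans (Hv z zH) _; rewrite hw in wa; apply: connect_trans wa.
  rewrite above_connectC.
  have wx' : connect (above h m) w x.
    by apply: sub_rel_connect wx => y y' /(above_le (ltnW mw)); rewrite above'.
  apply: (connect_trans wx'); apply: connect1; rewrite /above /= xz (hH z zH) leqnn.
  by rewrite (connect_above wx') ?hw.
exists h'; split; last first.
  apply/proper_card/properP; split.
    apply/subsetP=> w; rewrite !inE /h'; case: ifP => [/andP[]//|_ /eqP hw].
    by have := le_hm w; rewrite hw ltnn.
  by exists u; rewrite !inE ?hH ?h'_H // ltn_eqF.
split.
- by move=> w; rewrite /h'; case: ifP => // _; apply: leqW.
- move=> i; rewrite ltnS leq_eqVlt => /orP[/eqP->|im]; first by rewrite pieceH.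
  by rewrite piece' //; apply: (pdec_connected dec).
- move=> w i j ti tj nij.
  have lem a : touch h' w a -> a <= m.
    case/touchP=> aw _; rewrite -ltnS; apply: leq_trans aw _.
    by rewrite /h'; case: ifP => // _; apply: leqW.
  case: (ltngtP j m) (lem j tj) => // [jm|jE] _;
    case: (ltngtP i m) (lem i ti) => // [im|iE] _; last 1 first.
  + by rewrite iE jE eqxx in nij.
  + by rewrite !piece' //; apply: (pdec_clique dec (v := w)) => //; apply: touch'.
  + by rewrite iE pieceH piece' //; apply: (touchm w j) => //; rewrite -iE.
  + have [|x [y [xH yi xy]]] := touchm w i _ ti im; first by rewrite -jE.
    by rewrite jE pieceH piece' //; exists y, x; rewrite edge_sym.
move=> i; rewrite ltnS leq_eqVlt => /orP[/eqP->|im]; last first.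
  have [d [dl dd]] := pdec_thin dec im; exists d; split=> [x y|].
    by rewrite (above' i (ltnW im)); apply: dl.
  by rewrite piece'.
exists (gdist (above h m) u); split=> [x y|d]; last by rewrite pieceH.
by rewrite above' // => xy; apply: gdist_lipschitz xy; apply: above_sym.
Qed.

Lemma decomposition : exists h, exists2 m, forall v, h v < m & partial_decomp (t - 3) h m.
Proof.
suff step n h m : partial_decomp (t - 3) h m -> #|[set w | h w == m]| <= n ->
    exists h, exists2 m, forall v, h v < m & partial_decomp (t - 3) h m.
  apply: (step _ (fun=> 0) 0); last exact: leqnn.
  by split=> // v i j /touchP[].
elim: n h m => [|n IHn] h m dec cn.
  exists h, m => // v; rewrite ltn_neqAle (pdec_le dec) andbT.
  move: cn; rewrite leqn0 cards_eq0 => /eqP/setP/(_ v).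
  by rewrite !inE => ->.
have [E|[v]] := set_0Vmem [set w | h w == m]; first by apply: (IHn h m) => //; rewrite E cards0.
rewrite inE => /eqP hv; have [h' [dec' lt']] := extend_decomp dec hv.
by apply: IHn dec' _; rewrite -ltnS (leq_trans lt').
Qed.

End Decomposition.

(** * Weakly reachable sets *)

Section WeakReach.
Variables (G : sgraph) (t : nat) (t_ge4 : 4 <= t).
Hypothesis Kt_free : ~ minor (complete_graph t) G.
Variables (h : G -> nat) (m : nat) (h_lt : forall v, h v < m).
Hypothesis dec : partial_decomp (t - 3) h m.

(** The weakly reachable set of the theory of generalised colouring numbers, for
    the preorder given by [h] in place of a linear order. *)
Definition wreach (k : nat) (v : G) : {set G} :=
  [set x | near (above h (h x)) k v x].

(** A piece is connected, so all its vertices lie in the same component above it. *)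
Lemma touch_piece y y' j : h y = h y' -> touch h y j -> touch h y' j.
Proof.
move=> hy /touchP[jy [w [z [yw wz hz]]]]; apply/touchP; rewrite -hy; split=> //.
exists w, z; split=> //; apply: connect_trans yw; rewrite hy.
have := pdec_connected dec (h_lt y') (x := y') (y := y).
rewrite !inE hy eqxx => /(_ isT isT); apply: sub_rel_connect => a b /=.
by rewrite !inE => /andP[/andP[/eqP ha /eqP hb] ab]; rewrite /above /= ha hb leqnn.
Qed.

Definition below : rel 'I_m := [rel i j : 'I_m | [exists y, (h y == i) && touch h y j]].

(** The component of [z] in piece [k], above level [k], contains the component
    of [y], so it touches piece [j] as well. *)
Lemma below_clique (i j k : 'I_m) : below i j -> below i k -> j < k -> below k j.
Proof.
case/existsP=> y /andP[/eqP hy tj] /existsP[y' /andP[/eqP hy' tk]] jk.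
have /touchP[ky [w [z [yw wz hz]]]] : touch h y k.
  by apply: touch_piece tk; rewrite hy'.
have /touchP[_ [a [b [ya ab hb]]]] := tj.
apply/existsP; exists z; rewrite hz eqxx; apply/touchP; rewrite hz; split=> //.
exists a, b; split=> //; rewrite above_connectC.
have sub := above_le (h := h) (ltnW ky).
apply: connect_trans (_ : connect _ w z).
  apply: connect_trans (sub_rel_connect sub yw).
  by rewrite above_connectC; apply: sub_rel_connect sub ya.
apply: connect1; rewrite /above /= wz hz leqnn !andbT.
by apply: leq_trans (ltnW ky) (connect_above yw _).
Qed.

Lemma below_degree (i : 'I_m) : #|[set j | below i j]| <= t - 2.
Proof.
have [y /eqP hy|no] := pickP (fun y => h y == i); last first.
  rewrite (_ : [set j | below i j] = set0) ?cards0 //; apply/setP=> j; rewrite !inE.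
  by apply/existsP=> -[y]; rewrite no.
apply: leq_trans (few_touched t_ge4 Kt_free y m dec).
apply/subset_leq_card/subsetP=> j; rewrite !inE => /existsP[y' /andP[/eqP hy']].
by apply: touch_piece; rewrite hy'.
Qed.

(** Follow the walk and record the successive minima of [h]: [y] lies in the
    lowest piece met so far, and each new minimum costs at least one step. *)
Lemma near_pieces l k v x : near (above h l) k v x ->
  exists y, [/\ near below k (Ordinal (h_lt v)) (Ordinal (h_lt y)),
    l <= h v -> l <= h y & h y <= h x /\ connect (above h (h y)) y x].
Proof.
elim: k x => [|k IHk] x /=.
  by move=> /eqP <-; exists v; rewrite eqxx connect0.
case/orP=> [/IHk[y [vy ly yx]]|/existsP[w /andP[/IHk[y [vy ly [hyw yw]]] /and3P[lw lx wx]]]].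
  by exists y; rewrite vy.
have [hyx|hxy] := leqP (h y) (h x).
  exists y; rewrite vy; split=> //; split=> //; apply: connect_trans yw _.
  by apply: connect1; rewrite /above /= hyw hyx.
exists x; split=> //; apply/orP; right; apply/existsP; exists (Ordinal (h_lt y)).
rewrite vy; apply/existsP; exists y; rewrite eqxx; apply/touchP; split=> //.
by exists w, x.
Qed.

Lemma near_above_le k l v x : near (above h l) k v x -> l <= h x -> l <= h v.
Proof.
move/near_connect; rewrite above_connectC; exact: connect_above.
Qed.

Lemma near_lipschitz k l (delta : G -> nat) v x :
    (forall y z, above h l y z -> delta z <= (delta y).+1) ->
  near (above h l) k v x -> delta x <= delta v + k.
Proof.
move=> dl; elim: k x => [|k IHk] x /=; first by move/eqP->; rewrite addn0.
case/orP=> [/IHk|/existsP[w /andP[/IHk + /dl]]]; lia.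
Qed.

(** [delta] changes by at most [k] between [v] and a vertex within distance [k],
    so it takes at most [2k+1] values, each at most [t - 3] times. *)
Lemma card_wreach_piece k v i :
  #|[set x in wreach k v | h x == i]| <= (2 * k).+1 * (t - 3).
Proof.
have [im|mi] := ltnP i m; last first.
  rewrite (_ : [set _ in _ | _] = set0) ?cards0 //; apply/setP=> x; rewrite !inE.
  by rewrite (@ltn_eqF (h x)) ?andbF // (leq_trans (h_lt x)).
have [delta [dl dd]] := pdec_thin dec im.
have bnd x : x \in wreach k v -> h x = i -> delta x <= delta v + k /\ delta v <= delta x + k.
  rewrite inE => + hx; rewrite hx => vx; split; first exact: near_lipschitz vx.
  by apply: near_lipschitz dl (nearC (@above_sym _ h i) vx).
rewrite -[X in X * _]card_ord -cardsT.
apply: (@card_fibers _ _ (fun x => inord (delta x + k - delta v) : 'I_(2 * k).+1)) => [x _|j _].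
  by rewrite inE.
apply: leq_trans (dd (delta v + j - k)); apply/subset_leq_card/subsetP=> x.
rewrite inE => /andP[]; rewrite inE => /andP[xr /eqP hx] /eqP/(congr1 val) /=.
have [b1 b2] := bnd x xr hx.
rewrite inordK; last by lia.
by rewrite !inE hx eqxx /= => <-; apply/eqP; lia.
Qed.

Lemma card_wreach k v : #|wreach k v| <= k.+1 ^ (t - 2) * ((2 * k).+1 * (t - 3)).
Proof.
pose o x := Ordinal (h_lt x).
apply: (@leq_trans (#|[set j | near below k (o v) j]| * ((2 * k).+1 * (t - 3)))).
  apply: (@card_fibers _ _ o) => [x|j _].
    rewrite !inE => vx; have [y [vy ly [yx _]]] := near_pieces vx.
    have -> // : o x = o y.
    apply: val_inj; apply/eqP; rewrite eqn_leq yx andbT /= ly //.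
    exact: near_above_le vx _.
  apply: leq_trans (card_wreach_piece k v j).
  by apply/subset_leq_card/subsetP=> x; rewrite !inE => /andP[-> /eqP<-] /=.
rewrite leq_mul2r near_chordal ?orbT // => [i j|i j k'|i _].
- by case/existsP=> y /andP[/eqP<- /touchP[]].
- exact: below_clique.
exact: below_degree.
Qed.

(** [x] is a vertex of least height on the walk. *)
Lemma near_lowest k u v : near (@edge G) k u v ->
  exists x i j, [/\ i + j <= k, near (above h (h x)) i u x & near (above h (h x)) j v x].
Proof.
elim: k v => [|k IHk] v /=; first by move/eqP<-; exists u, 0, 0; rewrite !near_refl.
case/orP=> [/IHk[x [i [j [ij ux vx]]]]|]; first by exists x, i, j; rewrite leqW.
case/existsP=> w /andP[/IHk[x [i [j [ij ux wx]]]] wv].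
have hw : h x <= h w by apply: near_above_le wx _.
have [hv|hv] := leqP (h x) (h v).
  exists x, i, j.+1; rewrite addnS ltnS; split=> //.
  rewrite -add1n; apply: near_trans wx; apply: near1.
  by rewrite /above /= hw hv edge_sym.
exists v, (i + j).+1, 0; rewrite addn0 ltnS near_refl; split=> //.
have lt := above_le (h := h) (ltnW hv).
apply: near_rcons (_ : above h (h v) w v).
  apply: near_trans (sub_near lt ux) _.
  by apply: nearC; [exact: above_sym | exact: sub_near wx].
by rewrite /above /= leqnn wv (leq_trans _ hw) // ltnW.
Qed.
End WeakReach.

(** * Profiles and distances *)

Section Profiles.
Variable G : sgraph.
Local Notation E := (@edge G).

Lemma dist_leE k (u v : G) :
  (if dist u v is Some d then d <= k else false) = near E k u v.
Proof.
case D : (dist u v) => [d|].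
  have [/existsP[p /andP[pp /eqP lp]] dmin] := (dist_SomeP u v d).1 D.
  apply/idP/idP => [dk|/near_path[q [qq lq] sq]].
    by apply: near_mono dk _; have := path_near pp; rewrite size_tuple lp.
  apply: leq_trans sq; apply: dmin; apply/existsP; exists (in_tuple q).
  by rewrite qq lq /=.
by apply/esym/negP=> /near_connect; apply/dist_NoneP.
Qed.

Lemma eq_profile r (A : {set G}) u u' :
    (forall i a, i <= r -> a \in A -> near E i u a = near E i u' a) ->
  profile r A u = profile r A u'.
Proof.
move=> eqn; apply/ffunP=> -[a aA]; rewrite !ffunE /=.
have {eqn} := fun i (ir : i <= r) => eqn i a ir aA.
move=> eqn; have {eqn} eqn i : i <= r ->
    (if dist u a is Some d then d <= i else false) =
    (if dist u' a is Some d then d <= i else false).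
  by rewrite !dist_leE; apply: eqn.
case: (dist u a) (dist u' a) eqn => [d|] [d'|] eqn //=.
- have [dr|rd] := leqP d r.
    have d'd : d' <= d by rewrite -eqn.
    have dd' : d <= d' by rewrite eqn // (leq_trans d'd).
    by congr insub; apply/eqP; rewrite eqn_leq dd'.
  have := eqn r (leqnn r); rewrite leqNgt rd /= => /esym/negbT; rewrite -ltnNge => rd'.
  by rewrite !insubF // leqNgt ltnS ?rd ?rd'.
- rewrite insubF //; rewrite ltnS; exact: eqn r (leqnn r).
- by rewrite insubF //; rewrite ltnS; apply/esym/(eqn r).
Qed.

Lemma profile_near r (A : {set G}) u : profile r A u != [ffun => None] ->
  exists2 a, a \in A & near E r u a.
Proof.
move=> nt; have [/existsP[a /andP[aA ua]]|no] := boolP [exists a, (a \in A) && near E r u a].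
  by exists a.
case/eqP: nt; apply/ffunP=> -[a aA]; rewrite !ffunE /=.
have : ~~ near E r u a.
  by apply: contra no => ua; apply/existsP; exists a; rewrite aA.
rewrite -dist_leE; case: (dist u a) => //= d nd.
by rewrite insubF // ltnS; apply: negPf.
Qed.
End Profiles.

(** * Counting profiles *)

Section Counting.
Variables (G : sgraph) (t r : nat) (t_ge4 : 4 <= t).
Hypothesis Kt_free : ~ minor (complete_graph t) G.
Local Notation E := (@edge G).

(** The distances from [u] to [S], truncated at [r], as a set of balls. *)
Definition trace (S : {set G}) (u : G) : {set G * 'I_r.+1} :=
  [set p : G * 'I_r.+1 | (p.1 \in S) && near E p.2 p.1 u].

Lemma card_traces (S : {set G}) :
  #|[set trace S u | u : G]| <= (#|S| * r.+1).+1 ^ (t - 1).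
Proof.
have -> : #|S| * r.+1 = #|setX S [set: 'I_r.+1]| by rewrite cardsX cardsT card_ord.
apply: sauer => [_ /imsetP[u _ ->]|Y].
  by apply/subsetP=> p; rewrite !inE => /andP[->].
rewrite -subSn 1?subn1 /=; last exact: leq_trans t_ge4.
move=> cY shY; apply: Kt_free.
pose g (i : 'I_t) := enum_val (cast_ord (esym cY) i).
have gY i : g i \in Y by apply: enum_valP.
have g_inj : injective g by move=> i j /enum_val_inj/cast_ord_inj.
apply: (@shattered_balls_minor G t r (fun i => (g i).1) (fun i => (g i).2)).
  by move=> i; rewrite -ltnS.
move=> Z; have [|_ /imsetP[u _ ->] eZ] := shY (g @: Z).
  by apply/subsetP=> _ /imsetP[i _ ->].
have [|_ /imsetP[u0 _ ->] eY] := shY Y; first exact: subxx.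
exists u => i; rewrite -(mem_imset _ _ g_inj) -eZ !inE gY andbT.
by have := gY i; rewrite -{1}eY !inE => /andP[/andP[-> _] _].
Qed.

Variables (h : G -> nat) (m : nat) (h_lt : forall v, h v < m).
Hypothesis dec : partial_decomp (t - 3) h m.
Variable A : {set G}.

Definition wreach_from_A : {set G} := \bigcup_(a in A) wreach h r a.

(** [v] is an anchor of [u] when it weakly reaches every vertex through which a
    walk of length at most [r] from [u] to [A] may pass at its lowest point. *)
Definition anchor (v u : G) : bool :=
  wreach h r u :&: wreach_from_A \subset wreach h (2 * r) v.

(** Take for [v] a highest vertex of [X := wreach h r u :&: wreach_from_A].  For [x]
    in [X], the walks from [v] to [u] and from [u] to [x] both stay above [x]. *)
Lemma anchor_exists u : profile r A u != [ffun => None] ->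
  exists2 v, v \in wreach_from_A & anchor v u.
Proof.
case/profile_near=> a aA /(near_lowest h)[x0 [i [j [ij ux ax]]]].
have x0P : x0 \in wreach h r u :&: wreach_from_A.
  rewrite inE; apply/andP; split.
    by rewrite inE; apply: near_mono ux; apply: leq_trans ij; apply: leq_addr.
  apply/bigcupP; exists a; rewrite // inE.
  by apply: near_mono ax; apply: leq_trans ij; apply: leq_addl.
case: (@arg_maxnP _ x0 (mem (wreach h r u :&: wreach_from_A)) h x0P) => v /= vP vmax.
exists v; first by case/setIP: vP.
apply/subsetP=> x /[dup] /vmax /= xv; rewrite !in_setI => /andP[ux' _].
move: vP; rewrite in_setI => /andP[uv _]; rewrite !inE in ux' uv *.
rewrite mul2n -addnn; apply: near_trans ux'.
by apply: nearC; [exact: above_sym | apply: sub_near uv; exact: above_le].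
Qed.

(** A walk from [u] to [a] splits at its lowest vertex [x], which the anchor
    weakly reaches; the trace tells how far [x] is from [u'], and the second half
    of the walk is unchanged. *)
Lemma anchored_profile v u u' : anchor v u -> anchor v u' ->
  trace (wreach h (2 * r) v) u = trace (wreach h (2 * r) v) u' ->
  profile r A u = profile r A u'.
Proof.
suff le1 w w' : anchor v w ->
    trace (wreach h (2 * r) v) w = trace (wreach h (2 * r) v) w' ->
    forall i a, i <= r -> a \in A -> near E i w a -> near E i w' a.
  move=> gu gu' tuu'; apply: eq_profile => i a ir aA.
  by apply/idP/idP; apply: le1.
move=> gw tww' k a kr aA /(near_lowest h)[x [i [j [ij wx ax]]]].
have ik : i <= r by apply: leq_trans (leq_addr j i) (leq_trans ij kr).
have jk : j <= r by apply: leq_trans (leq_addl i j) (leq_trans ij kr).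
have subE l : subrel (above h l) E by move=> y z /and3P[].
have xv : x \in wreach h (2 * r) v.
  apply: (subsetP gw); rewrite in_setI inE (near_mono ik wx).
  by apply/bigcupP; exists a; rewrite // inE (near_mono jk ax).
have i_lt : i < r.+1 by [].
have : (x, Ordinal i_lt) \in trace (wreach h (2 * r) v) w.
  by rewrite inE /= xv; apply: nearC (@edge_sym G) (sub_near (subE _) wx).
rewrite tww' inE /= => /andP[_ xw'].
apply: near_mono ij _; apply: near_trans (nearC (@edge_sym G) xw') _.
exact: nearC (@edge_sym G) (sub_near (subE _) ax).
Qed.

(** A profile is decoded from an anchor and a trace; the first two factors bound
    the number of anchors, the last one the number of traces for each anchor. *)
Lemma card_profiles :
  #|profiles r [set: G] A| <=
    #|A| * (r.+1 ^ (t - 2) * ((2 * r).+1 * (t - 3))) *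
    (((2 * r).+1 ^ (t - 2) * ((2 * (2 * r)).+1 * (t - 3))) * r.+1).+1 ^ (t - 1).
Proof.
pose W v := wreach h (2 * r) v.
pose code := [set q : G * {set G * 'I_r.+1} |
  (q.1 \in wreach_from_A) && [exists u, anchor q.1 u && (trace (W q.1) u == q.2)]].
pose decode (q : G * {set G * 'I_r.+1}) : profile_type r A :=
  if [pick u | anchor q.1 u && (trace (W q.1) u == q.2)] is Some u
  then profile r A u else [ffun => None].
apply: (@leq_trans #|code|).
  apply: leq_trans (leq_imset_card decode _); apply/subset_leq_card/subsetP=> f.
  rewrite inE => /andP[+ /imsetP[u _ fu]]; rewrite inE fu => /anchor_exists[v vR gvu].
  apply/imsetP; exists (v, trace (W v) u).
    by rewrite inE /= vR; apply/existsP; exists u; rewrite gvu eqxx.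
  rewrite /decode; case: pickP => [u' /= /andP[gvu' /eqP tu]|/(_ u)].
    by apply: (anchored_profile gvu gvu'); rewrite tu.
  by rewrite /= gvu eqxx.
have cR : #|wreach_from_A| <= #|A| * (r.+1 ^ (t - 2) * ((2 * r).+1 * (t - 3))).
  rewrite -sum_nat_const /wreach_from_A; elim/big_rec2: _ => [|a n B _ leB]; first by rewrite cards0.
  apply: leq_trans (leq_card_setU _ _) _; apply: leq_add => //.
  exact: card_wreach dec _ _.
apply: leq_trans (leq_mul cR (leqnn _)).
apply: (@card_fibers _ _ fst) => [q|v _]; first by rewrite inE => /andP[].
apply: leq_trans (_ : #|[set trace (W v) u | u : G]| <= _).
  rewrite -[leqRHS](card_imset _ (f := pair v)) => [|S S' [] //].
  apply/subset_leq_card/subsetP=> -[v' S]; rewrite !inE /= => /andP[/andP[_ /existsP[u /andP[_ /eqP<-]]] /eqP->].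
  by rewrite !imset_f.
apply: leq_trans (card_traces _) _; apply: leq_exp_base; rewrite ltnS leq_mul2r /=.
exact: card_wreach dec _ _.
Qed.
End Counting.

Lemma collect_exponents b q s n :
  b * s * q ^ n * (b ^ n.+2 * s * q ^ n.+1) ^ n =
  (b ^ n.+1 * s) ^ n.+1 * q ^ (n.+1 ^ 2 - 1).
Proof.
have eb : b ^ (n.+1 * n.+1) = b * b ^ (n.+2 * n) by rewrite -expnS; congr (_ ^ _); lia.
have eq : q ^ (n.+1 ^ 2 - 1) = q ^ n * q ^ (n.+1 * n) by rewrite -expnD; congr (_ ^ _); lia.
rewrite (expnMn _ (q ^ n.+1)) (expnMn (b ^ n.+2)) (expnMn (b ^ n.+1)) -!expnM.
by rewrite eb eq (expnS s n); lia.
Qed.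

(** The first two estimates use [2r+1 <= 2q] and [4r+1 <= 4q] for [q := r+1]; the
    successor in the Sauer-Shelah bound is absorbed by a factor 2. *)
Lemma count_bound a t r : 4 <= t ->
  a * (r.+1 ^ (t - 2) * ((2 * r).+1 * (t - 3))) *
    (((2 * r).+1 ^ (t - 2) * ((2 * (2 * r)).+1 * (t - 3))) * r.+1).+1 ^ (t - 1) <=
  (2 ^ t * (t - 3)) ^ t * r.+1 ^ (t ^ 2 - 1) * a.
Proof.
move=> t4; rewrite [leqRHS]mulnC -mulnA leq_mul2l; apply/orP; right.
have [s st] : exists s, t = s.+3 by exists (t - 3); lia.
have s_gt0 : 0 < s by lia.
have -> : t - 3 = s by lia. have -> : t - 2 = s.+1 by lia. have -> : t - 1 = s.+2 by lia.
set q := r.+1.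
have W1 : q ^ s.+1 * ((2 * r).+1 * s) <= 2 * s * q ^ s.+2.
  have : (2 * r).+1 <= 2 * q by lia.
  by rewrite [q ^ s.+2]expnS => /(leq_mul (leqnn (q ^ s.+1 * s))); lia.
have W2 : ((2 * r).+1 ^ s.+1 * ((2 * (2 * r)).+1 * s) * q).+1 <= 2 ^ s.+4 * s * q ^ s.+3.
  have e1 : (2 * r).+1 ^ s.+1 <= 2 ^ s.+1 * q ^ s.+1 by rewrite -expnMn leq_exp2r //; lia.
  have e2 : (2 * (2 * r)).+1 <= 4 * q by lia.
  have e3 := leq_mul e1 (leq_mul (leq_mul e2 (leqnn s)) (leqnn q)).
  rewrite [2 ^ s.+4]expnS.
  have -> : 2 * 2 ^ s.+3 * s * q ^ s.+3 = 2 * (2 ^ s.+1 * q ^ s.+1 * (4 * q * s * q)).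
    by rewrite !(expnS _ s.+2) !(expnS _ s.+1); lia.
  have pos : 0 < 2 ^ s.+1 * q ^ s.+1 * (4 * q * s * q) by rewrite !muln_gt0 !expn_gt0 s_gt0.
  by rewrite -mulnA; lia.
apply: leq_trans (leq_mul W1 (leq_exp_base s.+2 W2)) _.
by rewrite st collect_exponents.
Qed.

Theorem theorem15 (t r : nat) (ht : 4 <= t) (hr : 0 < r) (G : sgraph)
    (hG : ~ minor (complete_graph t) G) (A : {set G}) :
  #|profiles r [set: G] A|
    <= (2 ^ t * (t - 3)) ^ t * r.+1 ^ (t ^ 2 - 1) * #|A|.
Proof.
have [h [m h_lt dec]] := decomposition ht hG.
exact: leq_trans (card_profiles r ht hG h_lt dec A) (count_bound _ _ ht).
Qed.
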